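(* There exist universal constants $c\in(0,1)$ and $C_3,C_4>0$ such that for all $n,d\in\mathbb{N}$ with $1\le n\le cd$, writing $\alpha=n/d$, $$|\sqrt nS|\le|\sqrt nB|\le C_3\,2^n\binom dn\exp\Big(\frac{n\alpha^3}{8}+O(n\alpha^4)\Big)\le C_4|\sqrt nS| .$$ In particular, if $n=O(d^{3/4})$ (that is, for every fixed $A>0$ and all such $n,d$ with in addition $n\le A d^{3/4}$), then $$|\sqrt nS\cap\{-1,0,1\}^d|\le|\sqrt nS|\le|\sqrt nB|\le C_5\,2^n\binom dn=C_5\,|\sqrt nS\cap\{-1,0,1\}^d| ,$$ where the constant $C_5>0$ depends only on the implied constant $A$.
   Context: $\mathbb{N}=\{1,2,\dots\}$. $\sqrt nS=\{x\in\mathbb{Z}^d:\sum_{j=1}^dx_j^2=n\}$ and $\sqrt nB=\{x\in\mathbb{Z}^d:\sum_{j=1}^dx_j^2\le n\}$; $|\cdot|$ denotes the number of elements. The symbol $O(n\alpha^4)$ denotes a real quantity $E(n,d)$ (the same in both inequalities) with $|E(n,d)|\le C n\alpha^4$ for a universal constant $C$. *)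

(* Defs.v *)
From HB Require Import structures.
From mathcomp Require Import all_boot all_order all_algebra finmap.
From mathcomp Require Import all_classical all_reals all_analysis.

Import Order.TTheory GRing.Theory Num.Theory.
Local Open Scope classical_set_scope.
Local Open Scope ring_scope.

Definition lattice_sphere (n d : nat) : set 'rV[int]_d :=
  [set x | \sum_(j < d) x 0 j ^+ 2 = n%:Z].

Definition lattice_ball (n d : nat) : set 'rV[int]_d :=
  [set x | \sum_(j < d) x 0 j ^+ 2 <= n%:Z].

Definition ternary_cube (d : nat) : set 'rV[int]_d :=
  [set x | forall j : 'I_d, x 0 j \in [:: -1; 0; 1]].

(* [fset_set] is empty on infinite sets; [finite_lattice_ball] and
   [finite_lattice_sphere] show that [card_pts] is the actual number of points
   on the sets above. *)
Definition card_pts {d : nat} (A : set 'rV[int]_d) : nat :=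
  #|` fset_set A|%fset.

Lemma lattice_sphere_ball (n d : nat) : lattice_sphere n d `<=` lattice_ball n d.
Proof. by move=> x; rewrite /lattice_sphere /lattice_ball /= => ->. Qed.

Lemma finite_lattice_ball (n d : nat) : finite_set (lattice_ball n d).
Proof.
pose f (g : {ffun 'I_d -> 'I_(n + n).+1}) : 'rV[int]_d :=
  \row_j ((g j : nat)%:Z - n%:Z).
apply: (@sub_finite_set _ _ (f @` [set: {ffun 'I_d -> 'I_(n + n).+1}])); last first.
  exact/finite_image/finite_finset.
rewrite /lattice_ball => x /= xn.
have xj j : `|x 0 j| <= n%:Z.
  have x2 : x 0 j ^+ 2 <= n%:Z.
    apply: le_trans xn; rewrite (bigD1 j)//= lerDl sumr_ge0// => i _.
    exact: sqr_ge0.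
  apply: le_trans x2; rewrite -(ger0_norm (sqr_ge0 (x 0 j))) expr2 normrM.
  have [->|x0] := eqVneq (x 0 j) 0; first by rewrite normr0.
  by rewrite ler_peMr// -gtz0_ge1 normr_gt0.
exists [ffun j : 'I_d => inord (absz (x 0 j + n%:Z)%R)] => //.
apply/rowP => j; rewrite mxE ffunE.
have := xj j; rewrite ler_norml => /andP[h1 h2].
have h0 : 0 <= x 0 j + n%:Z by rewrite -lerBlDr sub0r.
rewrite inordK ?gez0_abs ?addrK//.
by rewrite ltnS -lez_nat gez0_abs// PoszD lerD2r.
Qed.

Lemma finite_lattice_sphere (n d : nat) : finite_set (lattice_sphere n d).
Proof. exact: sub_finite_set (lattice_sphere_ball n d) (finite_lattice_ball n d). Qed.

(* Main.v *)
Require Import Defs.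
From HB Require Import structures.
From mathcomp Require Import all_boot all_order all_algebra finmap.
From mathcomp Require Import all_classical all_reals all_analysis.
From mathcomp Require Import zify ring lra.

Import Order.TTheory GRing.Theory Num.Theory.
Local Open Scope classical_set_scope.
Local Open Scope ring_scope.

(** The number of points on the sphere is the coefficient of [X^n] in
    [theta^d], where [theta = 1 + 2X + 2X^4 + 2X^9 + ...], because each
    coordinate [x] contributes a factor [X^(x^2)]. Write [a = n/d] and
    [T = 2^n * C(d, n)], the coefficient of [X^n] in [(1 + 2X)^d], which counts
    the points of the sphere with all coordinates in {-1, 0, 1}. Three estimates
    give everything, for [n <= d/8].

    The ball is at most twice the sphere ([card_ball_le_sphere]). Turning a zero
    coordinate into 1 or -1 leads from the sphere of squared radius [m] to that of
    [m + 1]: every point has at least [d - m] zeros, and every point of the target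
    arises at most [m + 1] times. Hence the counts at least double at each
    step, and summing over the radii is a geometric series. On coefficients this
    double counting is a comparison of [theta^d] with its derivative.

    The sphere is at most [T * exp(n a^3 / 8 + O(n a^4))] ([coef_theta_upper]).
    Coordinates of absolute value at least 2 that use up [m] units of [n] leave
    [2^(n - m) * C(d, n - m) <= T * t^m] choices for the rest, where
    [t = n / (2 (d - n))]. Summing over all such choices gives
    [T * (1 + 2t^4 + 2t^9 + ...)^d <= T * exp(2 d t^4 + O(d t^5))], and
    [2 d t^4 = n a^3 / 8 + O(n a^4)].

    The sphere is at least [T * exp(n a^3 / 8 - O(n a^4) - 1)]
    ([coef_theta_lower]). It is enough to count the points that have [k]
    coordinates equal to 2 or -2, with [k <= K = floor(n^2 / d)], and the others
    in {-1, 0, 1}. With [y] close to [n a^3 / 8], the [k]-th count is at least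
    [T * y^k / k!], hence at least [T * C(K, k) * (y / K)^k], and
    [(1 + y / K)^K >= exp(y - y^2 / K)]. The cutoff [K] of order [n a] is small
    enough for [n - 4K] to be [n (1 - O(a))] and large enough for [y^2 / K] to
    be [O(n a^4)]. When [K = 0] the main exponent is at most 1 and [T] alone is
    a sufficient lower bound.

    The error term is the logarithm of the ratio of the sphere count to
    [T * exp(n a^3 / 8)], truncated from below at [- 14 n a^4]; the truncation
    costs at most a factor [e]. If [n <= A d^(3/4)] then [n a^3 = n^4 / d^3] is
    bounded by [A^4], so the exponential factor is bounded. *)

(** * Lattice points as coefficients of powers of theta polynomials *)

(** The part of the theta polynomial coming from coordinates [x] with
    [2 <= |x| <= N + 1]; it is empty for [N = 0]. *)
Definition theta_tail (R : realFieldType) (N : nat) : {poly R} :=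
  (\sum_(2 <= k < N.+2) 'X^(k ^ 2)) *+ 2.

(** The sum of [X^(x^2)] over the integers [|x| <= N + 1]. A truncation of the
    theta series keeps everything polynomial; the truncation is harmless for
    coefficients of index at most [N + 1], and for [N = 0] it counts vectors
    with entries in {-1, 0, 1}. *)
Definition theta (R : realFieldType) (N : nat) : {poly R} :=
  1 + 'X *+ 2 + theta_tail R N.

Definition box_range (N : nat) : seq int :=
  0 :: [seq Posz k.+1 | k <- iota 0 N.+1] ++ [seq Negz k | k <- iota 0 N.+1].

Lemma mem_box_range (N : nat) (x : int) : (x \in box_range N) = (absz x <= N.+1)%N.
Proof.
rewrite /box_range; move: (mem_iota 0 N.+1); move: (iota 0 N.+1) => r rE.
rewrite in_cons mem_cat; case: x => [[|k]|k] //.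
- rewrite (mem_map (f := fun k => Posz k.+1)); last by move=> a b [].
  rewrite rE add0n !ltnS; case: (k <= N)%N; rewrite ?orbT ?orbF //.
  by apply/negbTE/mapP => -[].
- rewrite (mem_map (f := Negz)); last by move=> a b [].
  rewrite rE add0n !ltnS; case: (k <= N)%N; rewrite ?orbT ?orbF //.
  by apply/negbTE/mapP => -[].
Qed.

Lemma uniq_box_range (N : nat) : uniq (box_range N).
Proof.
rewrite /box_range; move: (iota_uniq 0 N.+1); move: (iota 0 N.+1) => r ur.
rewrite cons_uniq mem_cat cat_uniq !map_inj_uniq ?ur ?andbT /=; try by move=> a b [].
apply/andP; split.
  by rewrite negb_or; apply/andP; split; apply/mapP => -[].
by apply/hasPn => x /mapP[k _ ->]; apply/mapP => -[].
Qed.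

Lemma theta_box (R : realFieldType) (N : nat) :
  theta R N = \sum_(x <- box_range N) 'X^(absz x ^ 2).
Proof.
rewrite big_cons big_cat !big_map expr0 /theta -addrA; congr (_ + _).
rewrite /theta_tail -mulrnDl mulr2n.
suff -> : 'X + \sum_(2 <= k < N.+2) 'X^(k ^ 2) =
  \sum_(j <- iota 0 N.+1) 'X^(j.+1 ^ 2) :> {poly R} by [].
by rewrite -[X in iota 0 X]subn0 -/(index_iota 0 N.+1) [RHS]big_nat_recl // 2!big_add1.
Qed.

(** Expanding the product of [d] sums, a vector [x] with entries in [s]
    contributes [X^(sum of x_j^2)], so the coefficient of [X^m] counts the
    vectors of squared norm [m]. *)
Lemma card_box_points (R : realFieldType) (s : seq int) (d m : nat) (A : set 'rV[int]_d) :
  uniq s -> finite_set A ->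
  (forall x, A x <-> (\sum_(j < d) (absz (x 0%R j)) ^ 2 = m)%N /\
                     forall j, x 0 j \in s) ->
  (card_pts A)%:R = ((\sum_(x <- s) 'X^(absz x ^ 2)) ^+ d)`_m :> R.
Proof.
move=> us fA AE.
pose g (f : {ffun 'I_d -> 'I_(size s)}) : 'rV[int]_d := \row_j s`_(f j).
have ginj : injective g.
  move=> f1 f2 /rowP e; apply/ffunP => j; have := e j; rewrite !mxE => /eqP.
  by rewrite nth_uniq // => /eqP/val_inj.
pose e (f : {ffun 'I_d -> 'I_(size s)}) := (\sum_(j < d) (absz (s`_(f j))%R) ^ 2)%N.
have -> : card_pts A = #|[pred f | e f == m]|.
  rewrite /card_pts.
  have -> : fset_set A = [fset g f | f in [pred f | e f == m]]%fset.
    apply/fsetP => x; rewrite in_fset_set //.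
    apply/idP/imfsetP => [/set_mem/AE[em xs]|[f /= + ->]].
      have jlt j : (index (x 0%R j) s < size s)%N by rewrite index_mem.
      exists [ffun j => Ordinal (jlt j)].
        apply/eqP; rewrite -em; apply: eq_bigr => j _.
        by rewrite ffunE /= nth_index.
      by apply/rowP => j; rewrite mxE ffunE /= nth_index.
    move=> /eqP em; apply/mem_set/AE; split=> [|j].
      by rewrite -em; apply: eq_bigr => j _; rewrite mxE.
    by rewrite mxE mem_nth.
  by rewrite card_imfset //= cardE.
rewrite (big_nth 0) big_mkord -[X in _ ^+ X]card_ord -prodr_const.
under eq_bigl => i do rewrite -topredE /=.
rewrite (bigA_distr_bigA (fun (_ : 'I_d) (i : 'I_(size s)) => 'X^(absz s`_i ^ 2))).
rewrite coef_sum -sum1_card natr_sum big_mkcond /=; apply: eq_bigr => f _.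
by rewrite -expr_sum coefXn inE eq_sym; case: eqP.
Qed.

Lemma sumr_sqr_absz (d : nat) (x : 'rV[int]_d) :
  \sum_(j < d) x 0 j ^+ 2 = (\sum_(j < d) (absz (x 0%R j)) ^ 2)%N%:Z.
Proof.
rewrite -[RHS]natz natr_sum; apply: eq_bigr => j _.
by rewrite natrX natz abszE real_normK ?num_real.
Qed.

Lemma card_lattice_sphere (R : realFieldType) (n d N : nat) : (n <= N.+1)%N ->
  (card_pts (lattice_sphere n d))%:R = (theta R N ^+ d)`_n :> R.
Proof.
move=> nN; rewrite theta_box; apply: card_box_points.
- exact: uniq_box_range.
- exact: finite_lattice_sphere.
move=> x; rewrite /lattice_sphere /= sumr_sqr_absz; split=> [[em]|[-> //]].
split=> // j; rewrite mem_box_range; apply: leq_trans nN.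
rewrite -em (bigD1 j) //=; apply: leq_trans (leq_addr _ _).
by rewrite expnS expn1; case: (absz _) => // k; rewrite leq_pmulr.
Qed.

Lemma card_ternary_sphere (R : realFieldType) (n d : nat) :
  (card_pts (lattice_sphere n d `&` ternary_cube d))%:R = (theta R 0 ^+ d)`_n :> R.
Proof.
rewrite theta_box; apply: card_box_points.
- exact: uniq_box_range.
- exact/finite_setIl/finite_lattice_sphere.
move=> x; rewrite /lattice_sphere /ternary_cube /= sumr_sqr_absz.
have xE j : (x 0 j \in [:: -1; 0; 1]) = (x 0 j \in box_range 0).
  by rewrite mem_box_range; case: (x 0 j) => [[|[|k]]|[|k]].
by split=> [[[->] h]|[-> h]]; split=> // j; rewrite ?xE // -xE.
Qed.

(** * Coefficientwise inequalities and the growth of the sphere counts *)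

Definition coef_nneg (R : realFieldType) (p : {poly R}) : Prop := forall i, 0 <= p`_i.

Lemma coef_nneg1 (R : realFieldType) : coef_nneg R 1.
Proof. by move=> i; rewrite coef1 ler0n. Qed.

Lemma coef_nnegXn (R : realFieldType) (k : nat) : coef_nneg R 'X^k.
Proof. by move=> i; rewrite coefXn ler0n. Qed.

Lemma coef_nnegD (R : realFieldType) (p q : {poly R}) :
  coef_nneg R p -> coef_nneg R q -> coef_nneg R (p + q).
Proof. by move=> p0 q0 i; rewrite coefD addr_ge0. Qed.

Lemma coef_nnegMn (R : realFieldType) (p : {poly R}) (k : nat) :
  coef_nneg R p -> coef_nneg R (p *+ k).
Proof. by move=> p0 i; rewrite coefMn mulrn_wge0. Qed.

Lemma coef_nnegM (R : realFieldType) (p q : {poly R}) :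
  coef_nneg R p -> coef_nneg R q -> coef_nneg R (p * q).
Proof. by move=> p0 q0 i; rewrite coefM sumr_ge0 // => j _; rewrite mulr_ge0. Qed.

Lemma coef_nnegX (R : realFieldType) (p : {poly R}) (k : nat) :
  coef_nneg R p -> coef_nneg R (p ^+ k).
Proof.
move=> p0; elim: k => [|k IHk]; first by rewrite expr0; apply: coef_nneg1.
by rewrite exprS; apply: coef_nnegM.
Qed.

Lemma coef_nneg_deriv (R : realFieldType) (p : {poly R}) :
  coef_nneg R p -> coef_nneg R p^`().
Proof. by move=> p0 i; rewrite coef_deriv mulrn_wge0. Qed.

Lemma ler_coef (R : realFieldType) (p q : {poly R}) (i : nat) :
  coef_nneg R (q - p) -> p`_i <= q`_i.
Proof. by move/(_ i); rewrite coefB subr_ge0. Qed.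

Lemma theta_tail_nneg (R : realFieldType) (N : nat) : coef_nneg R (theta_tail R N).
Proof.
apply: coef_nnegMn => i; rewrite coef_sum sumr_ge0 // => k _.
exact: coef_nnegXn.
Qed.

Lemma ternary_nneg (R : realFieldType) : coef_nneg R (1 + 'X *+ 2).
Proof.
apply: coef_nnegD; first exact: coef_nneg1.
by apply: coef_nnegMn; rewrite -['X]expr1; apply: coef_nnegXn.
Qed.

Lemma theta_nneg (R : realFieldType) (N : nat) : coef_nneg R (theta R N).
Proof. exact/coef_nnegD/theta_tail_nneg/ternary_nneg. Qed.

Lemma theta_tail_coef0 (R : realFieldType) (N : nat) : (theta_tail R N)`_0 = 0.
Proof.
rewrite coefMn coef_sum big_nat_cond big1 ?mul0rn // => k /andP[/andP[k2 _] _].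
by rewrite coefXn eq_sym expn_eq0; case: k k2.
Qed.

Lemma coef_ternary (R : realFieldType) (d i : nat) :
  ((1 + 'X *+ 2) ^+ d)`_i = 2 ^+ i * 'C(d, i)%:R :> R.
Proof.
rewrite exprDn coef_sum.
under eq_bigr => k _ do
  rewrite expr1n mul1r exprMn_n -mulrnA coefMn coefXn.
have [id|di] := leqP i d; last first.
  rewrite (bin_small di) mulr0 big1 // => k _.
  by rewrite gtn_eqF ?mul0rn // (leq_trans (ltn_ord k)).
have idS : (i < d.+1)%N by [].
rewrite (bigD1 (Ordinal idS)) //= eqxx big1 ?addr0 ?mulrnA ?natrX // => [|k].
  by rewrite -natrX -natrM -mulrnA.
by rewrite -val_eqE eq_sym /= => /negbTE ->; rewrite mul0rn.
Qed.

Lemma deriv_theta (R : realFieldType) (N : nat) :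
  (theta R N)^`() = 2 + (theta_tail R N)^`().
Proof. by rewrite /theta -polyC1 2!derivD derivC derivMn derivX add0r. Qed.

Lemma coef_X_deriv (R : realFieldType) (p : {poly R}) (m : nat) :
  ('X * p^`())`_m = m%:R * p`_m.
Proof.
rewrite coefXM; case: m => [|m] /=; first by rewrite mul0r.
by rewrite coef_deriv mulr_natl.
Qed.

(** Double counting of pairs made of a point of squared norm [m + 1] in dimension
    [d + 1] and a coordinate, weighted by the square of that coordinate: the
    weights of each point add up to [m + 1], and the coordinates equal to 1 or
    -1 alone give the left-hand side. *)
Lemma coef_thetaS_lower (R : realFieldType) (N d m : nat) :
  2 * d.+1%:R * (theta R N ^+ d)`_m <= m.+1%:R * (theta R N ^+ d.+1)`_m.+1.
Proof.
rewrite [leRHS]mulr_natl -coef_deriv deriv_exp /= coefMn -[leRHS]mulr_natl.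
rewrite mulrC mulrA [in leRHS]mulrC ler_wpM2r // mulrC.
have -> : 2 * (theta R N ^+ d)`_m = (2%:P * theta R N ^+ d)`_m by rewrite coefCM.
apply: ler_coef; rewrite -mulrBl; apply: coef_nnegM; last exact/coef_nnegX/theta_nneg.
rewrite deriv_theta rmorph_nat addrAC subrr add0r.
exact/coef_nneg_deriv/theta_tail_nneg.
Qed.

(** Double counting of pairs made of a point of squared norm [m] in dimension
    [d + 1] and one of its zero coordinates; a point has at most [m] nonzero
    coordinates. The inequality [1 - [x <> 0] >= 1 - x^2] behind this bound is
    the nonnegativity of the coefficients of [X * tail' - tail]. *)
Lemma coef_thetaS_upper (R : realFieldType) (N d m : nat) :
  (d.+1%:R - m%:R) * (theta R N ^+ d.+1)`_m <= d.+1%:R * (theta R N ^+ d)`_m.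
Proof.
have -> : (d.+1%:R - m%:R) * (theta R N ^+ d.+1)`_m =
    (d.+1%:R *: theta R N ^+ d.+1 - 'X * (theta R N ^+ d.+1)^`())`_m.
  by rewrite coefB coefZ coef_X_deriv mulrBl.
rewrite -coefZ; apply: ler_coef.
rewrite deriv_exp /= !scaler_nat.
have -> : theta R N ^+ d *+ d.+1 - (theta R N ^+ d.+1 *+ d.+1 -
    'X * ((theta R N)^`() * theta R N ^+ d *+ d.+1)) =
  ((1 - theta R N + 'X * (theta R N)^`()) * theta R N ^+ d) *+ d.+1.
  rewrite exprS; move: (theta R N ^+ d) (theta R N)^`() (theta R N) => q p' p.
  rewrite mulrDl mulrBl mul1r mulrnDl mulrnBl opprB -addrA.
  by rewrite -!mulrA mulrnAr [X in _ + X]addrC.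
apply/coef_nnegMn/coef_nnegM; last exact/coef_nnegX/theta_nneg.
have -> : 1 - theta R N + 'X * (theta R N)^`() =
    'X * (theta_tail R N)^`() - theta_tail R N.
  rewrite deriv_theta /theta mulrDr mulr_natr.
  move: (theta_tail R N) (_ * _^`()) ('X *+ 2) => t y x.
  by rewrite !opprD !addrA subrr add0r [- x - t + x]addrAC addNr add0r addrC.
move=> i; rewrite coefB coef_X_deriv subr_ge0.
case: i => [|i]; first by rewrite theta_tail_coef0 mulr0.
by rewrite ler_peMl ?ler1n //; apply: theta_tail_nneg.
Qed.

(** The two double counts together bound the ratio of consecutive coefficients
    below by [2 (d - m) / (m + 1)], which is at least 2 in the given range. *)
Lemma coef_theta_growth (R : realFieldType) (N d m : nat) : (0 < d)%N ->
  (2 * m.+1 <= d.+1)%N ->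
  2 * (theta R N ^+ d)`_m <= (theta R N ^+ d)`_m.+1.
Proof.
case: d => // d _ md.
have H1 := coef_thetaS_lower R N d m.
have H2 := coef_thetaS_upper R N d m.
have m0 : 0 <= (theta R N ^+ d.+1)`_m by apply/coef_nnegX/theta_nneg.
have mp : 0 < m.+1%:R :> R by [].
rewrite -(ler_pM2l mp); apply: le_trans H1.
have : m.+1%:R <= d.+1%:R - m%:R :> R.
  by rewrite lerBrDr -natrD ler_nat; lia.
nra.
Qed.

(** * Upper bound *)

(** Each decrement of the lower index [k <= n] of [C(d, k)] costs a factor
    [k / (d - k + 1)], at most [n / (d - n)]. *)
Lemma bin_shift_leq (d n m : nat) : (m <= n)%N ->
  ('C(d, n - m) * (d - n) ^ m <= 'C(d, n) * n ^ m)%N.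
Proof.
elim: m => [|m IHm] mn; first by rewrite subn0 !expn0.
have -> : (n - m.+1 = (n - m).-1)%N by lia.
have kE : (n - m = (n - m).-1.+1)%N by lia.
have := mul_bin_left d (n - m).-1; rewrite -kE => E.
have H : ('C(d, (n - m).-1) * (d - n) <= n * 'C(d, n - m))%N.
  rewrite mulnC; apply: leq_trans (_ : (n - m) * 'C(d, n - m) <= _)%N.
    by rewrite E leq_mul2r; apply/orP; right; lia.
  by rewrite leq_mul2r leq_subr orbT.
rewrite expnS mulnA (leq_trans (leq_mul H (leqnn _))) // -mulnA.
by rewrite expnS [X in (_ <= X)%N]mulnCA leq_mul2l IHm ?orbT // ltnW.
Qed.

Lemma ternary_shift_le (R : realFieldType) (d n m : nat) : (m <= n)%N -> (n < d)%N ->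
  2 ^+ (n - m) * 'C(d, n - m)%:R <=
  2 ^+ n * 'C(d, n)%:R * (n%:R / (2 * (d%:R - n%:R))) ^+ m :> R.
Proof.
move=> mn nd; have dn0 : 0 < d%:R - n%:R :> R by rewrite subr_gt0 ltr_nat.
have := bin_shift_leq d n m mn.
rewrite -(ler_nat R) !natrM !natrX natrB 1?ltnW // => H.
have dnm0 : 0 < (d%:R - n%:R) ^+ m :> R by rewrite exprn_gt0.
have -> : 2 ^+ n = 2 ^+ (n - m) * 2 ^+ m :> R by rewrite -exprD subnK.
rewrite expr_div_n exprMn.
have -> : 2 ^+ (n - m) * 2 ^+ m * 'C(d, n)%:R *
   (n%:R ^+ m / (2 ^+ m * (d%:R - n%:R) ^+ m)) =
   2 ^+ (n - m) * ('C(d, n)%:R * n%:R ^+ m / (d%:R - n%:R) ^+ m) :> R.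
  by field; rewrite !lt0r_neq0 ?exprn_gt0.
by rewrite ler_pM2l ?exprn_gt0 // ler_pdivlMr.
Qed.

Lemma sum_coef_le_horner (R : realFieldType) (p : {poly R}) (t : R) (n : nat) :
  coef_nneg R p -> 0 <= t -> \sum_(j < n) p`_j * t ^+ j <= p.[t].
Proof.
move=> p0 t0; rewrite (@horner_coef_wide _ (n + size p)) ?leq_addl //.
rewrite big_split_ord /= lerDl sumr_ge0 // => i _.
by rewrite mulr_ge0 ?exprn_ge0.
Qed.

(** The coefficients of [(1 + 2X)^e] just below the [n]-th decay at
    least geometrically with ratio [t = n / (2 (d - n))], so multiplying by [p]
    costs at most a factor [p(t)]. Evaluating at this point, rather than at a
    saddle point of the whole product, avoids any loss of a power of [n]. *)
Lemma coef_mul_ternary_le (R : realFieldType) (p : {poly R}) (d e n : nat) :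
  coef_nneg R p -> (e <= d)%N -> (n < d)%N ->
  (p * (1 + 'X *+ 2) ^+ e)`_n <=
  2 ^+ n * 'C(d, n)%:R * p.[n%:R / (2 * (d%:R - n%:R))].
Proof.
move=> p0 ed nd; set t := n%:R / _; set T := 2 ^+ n * _.
have t0 : 0 <= t by rewrite divr_ge0 // mulr_ge0 // subr_ge0 ler_nat ltnW.
have T0 : 0 <= T by rewrite mulr_ge0 ?exprn_ge0.
apply: le_trans (ler_wpM2l T0 (sum_coef_le_horner R p t n.+1 p0 t0)).
rewrite coefM mulr_sumr; apply: ler_sum => j _.
rewrite mulrCA ler_wpM2l //.
apply: le_trans (ternary_shift_le R d n j _ nd); last by rewrite -ltnS.
by rewrite coef_ternary ler_wpM2l ?exprn_ge0 // ler_nat leq_bin2l.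
Qed.

(** Expand [theta^d] in powers of the tail, bound each term by
    [coef_mul_ternary_le], and recombine into [(1 + tail(t))^d]. *)
Lemma coef_theta_le (R : realType) (N d n : nat) : (n < d)%N ->
  (theta R N ^+ d)`_n <= 2 ^+ n * 'C(d, n)%:R *
    expR (d%:R * (theta_tail R N).[n%:R / (2 * (d%:R - n%:R))]).
Proof.
move=> nd; set t := n%:R / _; set T := 2 ^+ n * _.
have T0 : 0 <= T by rewrite mulr_ge0 ?exprn_ge0.
have t0 : 0 <= t by rewrite divr_ge0 // mulr_ge0 // subr_ge0 ler_nat ltnW.
have q0 : 0 <= (theta_tail R N).[t].
  apply: le_trans (sum_coef_le_horner R _ t 0 (theta_tail_nneg R N) t0).
  by rewrite big_ord0.
apply: (@le_trans _ _ (T * (1 + (theta_tail R N).[t]) ^+ d)); last first.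
  by rewrite ler_wpM2l // expRM_natl lerXn2r ?nnegrE ?expR_ge0
     ?addr_ge0 // expR_ge1Dx.
rewrite /theta !exprDn mulr_sumr coef_sum; apply: ler_sum => i _.
rewrite coefMn expr1n mul1r mulrnAr lerMn2r; apply/orP; right.
rewrite mulrC -horner_exp; apply: coef_mul_ternary_le => //.
  exact/coef_nnegX/theta_tail_nneg.
exact: leq_subr.
Qed.

(** For [k >= 3] the exponent [k^2] is at least [5 + (k - 3)], so the terms after
    [t^4] are dominated by [t^5] times a geometric series of ratio 1/2. The
    explicit remainder makes the induction go through. *)
Lemma sum_sqr_pow_le (R : realFieldType) (N : nat) (t : R) : 0 <= t -> t <= 1 / 2 ->
  \sum_(2 <= k < N.+3) t ^+ (k ^ 2) <= t ^+ 4 + 2 * t ^+ 5 * (1 - (1 / 2) ^+ N).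
Proof.
move=> t0 t2; elim: N => [|N IHN].
  by rewrite big_nat1 expr0 subrr mulr0 addr0.
rewrite big_nat_recr //=.
have step : t ^+ (N.+3 ^ 2) <= t ^+ 5 * (1 / 2) ^+ N.
  have -> : (N.+3 ^ 2 = (N * N + 5 * N + 4) + 5 + N)%N by rewrite expnS expn1; lia.
  rewrite exprD ler_pM ?exprn_ge0 ?lerXn2r ?nnegrE //.
  by rewrite exprD ler_piMl ?exprn_ge0 // exprn_ile1 //; lra.
rewrite [(1 / 2) ^+ N.+1]exprS; move: IHN step; move: (\sum_(_ <= _ < _) _) (t ^+ (N.+3 ^ 2)) ((1 / 2) ^+ N) => S u h.
lra.
Qed.

Lemma theta_tail_horner_le (R : realFieldType) (N : nat) (t : R) :
  0 <= t -> t <= 1 / 2 -> (theta_tail R N).[t] <= 2 * (t ^+ 4 + 2 * t ^+ 5).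
Proof.
move=> t0 t2; rewrite /theta_tail hornerMn horner_sum -[leLHS]mulr_natl ler_pM2l //.
under eq_bigr => k _ do rewrite hornerXn.
have t50 : 0 <= t ^+ 5 by rewrite exprn_ge0.
(* The tail is empty for [N = 0], where the geometric bound does not apply. *)
case: N => [|N].
  by rewrite big_geq // addr_ge0 ?mulr_ge0 ?exprn_ge0.
apply: le_trans (sum_sqr_pow_le R N t t0 t2) _.
rewrite lerD2l ler_piMr ?mulr_ge0 // gerBl exprn_ge0 //; lra.
Qed.

(** With [a = n/d], the evaluation point is [t = a / (2 (1 - a))], which is
    [a/2 * (1 + O(a))]; hence [2 d t^4] is [d a^4 / 8 = n a^3 / 8] up to [O(n a^4)].
    The constant 14 is [10 + 4], from the errors in [2 t^4] and in [4 t^5]. *)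
Lemma tail_exponent_le (R : realFieldType) (d n : R) : 0 < d -> 0 <= n -> 8 * n <= d ->
  d * (2 * ((n / (2 * (d - n))) ^+ 4 + 2 * (n / (2 * (d - n))) ^+ 5)) <=
  n * (n / d) ^+ 3 / 8 + 14 * (n * (n / d) ^+ 4).
Proof.
move=> d0 n0 nd; set a := n / d.
have aE : n = a * d by rewrite /a mulfVK ?lt0r_neq0.
have a0 : 0 <= a by rewrite divr_ge0 // ltW.
have a8 : a <= 1 / 8 by rewrite /a ler_pdivrMr //; lra.
have dn : 0 < d - n by lra.
set t := n / (2 * (d - n)).
have t0 : 0 <= t by rewrite divr_ge0 // mulr_ge0 // ltW.
have tle : t <= a / 2 * (1 + 2 * a).
  rewrite /t ler_pdivrMr ?mulr_gt0 // aE.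
  have -> : a / 2 * (1 + 2 * a) * (2 * (d - a * d)) = a * d * (1 + a - 2 * a ^+ 2).
    by field.
  have ad0 : 0 <= a * d by rewrite mulr_ge0 // ltW.
  have a12 : 0 <= a * (1 - 2 * a) by rewrite mulr_ge0 //; lra.
  by rewrite ler_peMr //; lra.
have ta : t <= a by apply: le_trans tle _; nra.
have t4 : t ^+ 4 <= a ^+ 4 / 16 * (1 + 80 * a).
  apply: le_trans (_ : (a / 2 * (1 + 2 * a)) ^+ 4 <= _).
    by rewrite lerXn2r // nnegrE // mulr_ge0 //; lra.
  have -> : (a / 2 * (1 + 2 * a)) ^+ 4 = a ^+ 4 / 16 * (1 + 2 * a) ^+ 4 by field.
  rewrite ler_wpM2l ?divr_ge0 ?exprn_ge0 //.
  have a1 : a <= 1 by lra.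
  have h2 : a ^+ 2 <= a by rewrite expr2 ler_piMl.
  have h3 : a ^+ 3 <= a by rewrite exprS ler_piMr // exprn_ile1.
  have h4 : a ^+ 4 <= a by rewrite exprS ler_piMr // exprn_ile1.
  have -> : (1 + 2 * a) ^+ 4 =
    1 + 8 * a + 24 * a ^+ 2 + 32 * a ^+ 3 + 16 * a ^+ 4 by ring.
  lra.
have t5 : t ^+ 5 <= a ^+ 5 by rewrite lerXn2r.
have -> : n * a ^+ 3 / 8 + 14 * (n * a ^+ 4) =
  d * (2 * (a ^+ 4 / 16 * (1 + 80 * a) + 2 * a ^+ 5)) by rewrite aE; field.
by rewrite ler_pM2l // ler_pM2l //; lra.
Qed.

Lemma coef_theta_upper (R : realType) (N d n : nat) : (0 < d)%N -> (8 * n <= d)%N ->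
  (theta R N ^+ d)`_n <= 2 ^+ n * 'C(d, n)%:R *
    expR (n%:R * (n%:R / d%:R) ^+ 3 / 8 + 14 * (n%:R * (n%:R / d%:R) ^+ 4)).
Proof.
move=> d0 nd; have nd' : 8 * n%:R <= d%:R :> R by rewrite -natrM ler_nat.
have dr0 : 0 < d%:R :> R by rewrite ltr0n.
have nr0 : 0 <= n%:R :> R by [].
apply: le_trans (coef_theta_le R N d n _) _; first lia.
rewrite ler_wpM2l ?mulr_ge0 ?exprn_ge0 // ler_expR.
apply: le_trans (tail_exponent_le R _ _ dr0 nr0 nd').
rewrite ler_pM2l //; apply: theta_tail_horner_le.
  by rewrite divr_ge0 // mulr_ge0 //; lra.
by rewrite ler_pdivrMr ?mulr_gt0 //; lra.
Qed.

(** * Lower bound *)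

Lemma ffact_leq_expn (n m : nat) : (n ^_ m <= n ^ m)%N.
Proof.
elim: m => [|m IHm] //; rewrite ffactnSr expnSr.
by rewrite leq_mul // leq_subr.
Qed.

Lemma leq_wexp2r (m n e : nat) : (m <= n)%N -> (m ^ e <= n ^ e)%N.
Proof. by case: e => // e mn; rewrite leq_exp2r. Qed.

Lemma expn_leq_ffact (n m : nat) : ((n - m) ^ m <= n ^_ m)%N.
Proof.
elim: m => [|m IHm]; first by rewrite expn0 ffactn0.
rewrite ffactnSr expnSr leq_mul ?leq_sub2l // (leq_trans _ IHm) //.
by rewrite leq_wexp2r // leq_sub2l.
Qed.

Lemma ffactD (n k m : nat) : (n ^_ (k + m) = n ^_ k * (n - k) ^_ m)%N.
Proof.
elim: m => [|m IHm]; first by rewrite addn0 ffactn0 muln1.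
by rewrite addnS !ffactnSr IHm subnDA mulnA.
Qed.

(** Trading four coordinates of absolute value 1 for one of absolute value 2,
    [k] times. Both sides are products of falling factorials of [d] and [n] in
    which [n ^_ (4k)] is bounded below by [(n - 4k)^(4k)] and the last [3k]
    factors of [d ^_ n] are bounded above by [d^(3k)]. *)
Lemma bin_leq_bin_twos (d n k : nat) : (4 * k <= n)%N -> (n <= d)%N ->
  ('C(d, n) * (n - 4 * k) ^ (4 * k) <=
   k`! * ('C(d, k) * 'C(d - k, n - 4 * k)) * d ^ (3 * k))%N.
Proof.
move=> kn nd.
rewrite -(leq_pmul2r (fact_gt0 (n - 4 * k))).
have h1 : ('C(d, k) * k`! * ('C(d - k, n - 4 * k) * (n - 4 * k)`!) =
   d ^_ (n - 3 * k))%N.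
  by rewrite !bin_ffact -ffactD; congr (_ ^_ _)%N; lia.
have h2 : (n ^_ (4 * k) * (n - 4 * k)`! = n`!)%N by rewrite ffact_fact.
have h3 : ('C(d, n) * n`! = d ^_ (n - 3 * k) * (d - (n - 3 * k)) ^_ (3 * k))%N.
  by rewrite bin_ffact -ffactD; congr (_ ^_ _)%N; lia.
apply: leq_trans (_ : 'C(d, n) * (n ^_ (4 * k) * (n - 4 * k)`!) <= _)%N.
  by rewrite mulnA leq_mul2r leq_mul2l expn_leq_ffact !orbT.
rewrite h2 h3.
apply: leq_trans (_ : d ^_ (n - 3 * k) * d ^ (3 * k) <= _)%N.
  rewrite leq_mul2l (leq_trans (ffact_leq_expn _ _)) ?orbT //.
  by rewrite leq_wexp2r // leq_subr.
by rewrite -h1; apply/eq_leq; ring.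
Qed.

Lemma coef_nneg_exp_mono (R : realFieldType) (p q : {poly R}) (d : nat) :
  coef_nneg R p -> coef_nneg R (q - p) -> coef_nneg R (q ^+ d - p ^+ d).
Proof.
move=> p0 qp; have q0 : coef_nneg R q by rewrite -[q](subrK p); apply: coef_nnegD.
elim: d => [|d IHd]; first by rewrite !expr0 subrr => i; rewrite coef0.
have -> : q ^+ d.+1 - p ^+ d.+1 = q * (q ^+ d - p ^+ d) + (q - p) * p ^+ d.
  by rewrite mulrBr mulrBl !exprS addrA subrK.
by apply: coef_nnegD; apply: coef_nnegM => //; apply: coef_nnegX.
Qed.

Lemma theta_tail_geX4 (R : realFieldType) (N : nat) :
  coef_nneg R (theta_tail R N.+1 - 'X^4 *+ 2).
Proof.
rewrite /theta_tail big_nat_recl // -mulrnBl addrAC subrr add0r.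
apply: coef_nnegMn => i; rewrite coef_sum sumr_ge0 // => k _.
exact: coef_nnegXn.
Qed.

(** The [k]-th term counts the points with [k] coordinates 2 or -2,
    [n - 4k] coordinates 1 or -1, and zeros elsewhere. *)
Lemma coef_theta_ge_sum (R : realFieldType) (N d n K : nat) :
  (4 * K <= n)%N -> (n <= d)%N ->
  \sum_(k < K.+1) 2 ^+ (n - 3 * k) * ('C(d, k) * 'C(d - k, n - 4 * k))%:R <=
  (theta R N.+1 ^+ d)`_n.
Proof.
move=> Kn nd.
have X4 : coef_nneg R ('X^4 *+ 2) by apply/coef_nnegMn/coef_nnegXn.
apply: (@le_trans _ _ ((1 + 'X *+ 2 + 'X^4 *+ 2) ^+ d)`_n); last first.
  apply/ler_coef/coef_nneg_exp_mono.
    exact/coef_nnegD/X4/ternary_nneg.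
  by rewrite /theta opprD addrACA subrr add0r; apply: theta_tail_geX4.
(* Only the terms of index [k <= K] of the expansion are kept. *)
have dE : (d.+1 = K.+1 + (d - K))%N by lia.
rewrite exprDn dE big_split_ord coefD /= -[leLHS]addr0 lerD //; last first.
  rewrite coef_sum sumr_ge0 // => k _; apply/coef_nnegMn/coef_nnegM.
    exact/coef_nnegX/ternary_nneg.
  exact/coef_nnegX.
rewrite coef_sum; apply: ler_sum => k _.
have kK : (k <= K)%N by rewrite -ltnS.
have -> : ('X^4 *+ 2) ^+ k = 'X^(4 * k) *+ 2 ^ k :> {poly R} by rewrite exprMn_n exprM.
rewrite [in leRHS]mulrnAr -[in leRHS]mulrnA [leRHS]coefMn coefMXn ltnNge.
have -> /= : (4 * k <= n)%N by lia.
rewrite coef_ternary -[leRHS]mulr_natr.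
have -> : (n - 3 * k = (n - 4 * k) + k)%N by lia.
by rewrite exprD !natrM natrX le_eqVlt; apply/orP; left; apply/eqP; ring.
Qed.

Lemma coef_theta_ge_bin (R : realFieldType) (N d n : nat) : (n <= d)%N ->
  2 ^+ n * 'C(d, n)%:R <= (theta R N.+1 ^+ d)`_n :> R.
Proof.
move=> nd; apply: le_trans (coef_theta_ge_sum R N d n 0 _ nd) => //.
by rewrite big_ord_recl big_ord0 addr0 !muln0 !subn0 bin0 mul1n.
Qed.

(** By [bin_leq_bin_twos] the [k]-th term of [coef_theta_ge_sum] is at least
    [T * y^k / k!] with [y = (n - 4K)^4 / (8 d^3)]. Since [C(K, k) <= K^k / k!], this
    dominates the [k]-th term of the binomial expansion of [(1 + y/K)^K], a finite
    substitute for the exponential series. *)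
Lemma coef_theta_ge_exp (R : realFieldType) (N d n K : nat) :
  (0 < K)%N -> (4 * K <= n)%N -> (n <= d)%N ->
  2 ^+ n * 'C(d, n)%:R *
    (1 + (n%:R - 4 * K%:R) ^+ 4 / (8 * d%:R ^+ 3) / K%:R) ^+ K <=
  (theta R N.+1 ^+ d)`_n :> R.
Proof.
move=> K0 Kn nd; apply: le_trans (coef_theta_ge_sum R N d n K Kn nd).
have d0 : 0 < d%:R :> R by rewrite ltr0n; lia.
set w := n%:R - 4 * K%:R; set y := w ^+ 4 / _.
have w0 : 0 <= w by rewrite subr_ge0 -natrM ler_nat.
have K0r : 0 < K%:R :> R by rewrite ltr0n.
rewrite [(1 + _) ^+ K]exprDn mulr_sumr; apply: ler_sum => k _.
have kK : (k <= K)%N by rewrite -ltnS.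
rewrite expr1n mul1r -[(y / _) ^+ k *+ _]mulr_natr.
have kf0 : 0 < k`!%:R :> R by rewrite ltr0n fact_gt0.
have binK : 'C(K, k)%:R <= K%:R ^+ k / k`!%:R :> R.
  by rewrite ler_pdivlMr // -natrM -natrX ler_nat bin_ffact ffact_leq_expn.
have k4 : (4 * k <= n)%N by lia.
have := bin_leq_bin_twos d n k k4 nd; rewrite -(ler_nat R) => H.
have y0 : 0 <= y / K%:R by rewrite !divr_ge0 ?exprn_ge0 // mulr_ge0 ?exprn_ge0 // ltW.
apply: (@le_trans _ _ (2 ^+ n * 'C(d, n)%:R * ((y / K%:R) ^+ k * (K%:R ^+ k / k`!%:R)))).
  by rewrite ler_wpM2l ?mulr_ge0 ?exprn_ge0 // ler_wpM2l ?exprn_ge0.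
have -> : (y / K%:R) ^+ k * (K%:R ^+ k / k`!%:R) = y ^+ k / k`!%:R.
  rewrite expr_div_n; field.
  by rewrite !lt0r_neq0 ?exprn_gt0.
have -> : y ^+ k = w ^+ (4 * k) / (8 ^+ k * d%:R ^+ (3 * k)).
  by rewrite /y expr_div_n [(8 * _) ^+ k]exprMn !exprM.
have -> : 2 ^+ n = 2 ^+ (n - 3 * k) * 8 ^+ k :> R.
  have -> : 8 = 2 ^+ 3 :> R by ring.
  by rewrite -exprM -exprD; congr (_ ^+ _); lia.
have E : 2 ^+ (n - 3 * k) * 8 ^+ k * 'C(d, n)%:R *
   (w ^+ (4 * k) / (8 ^+ k * d%:R ^+ (3 * k)) / k`!%:R) =
   2 ^+ (n - 3 * k) * ('C(d, n)%:R * w ^+ (4 * k) / (d%:R ^+ (3 * k) * k`!%:R)) :> R.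
  by field; rewrite !lt0r_neq0 ?exprn_gt0.
rewrite E ler_pM2l ?exprn_gt0 //.
rewrite ler_pdivrMr ?mulr_gt0 ?exprn_gt0 //.
move: H; rewrite !natrM !natrX => H.
apply: (le_trans _ (le_trans H _)).
  rewrite ler_wpM2l // lerXn2r ?nnegrE // natrB // natrM lerB //.
  by rewrite ler_pM2l // ler_nat.
by rewrite le_eqVlt; apply/orP; left; apply/eqP; ring.
Qed.

(** Since [exp(x^2 - x) >= 1 + x^2 - x] and [(1 + x) (1 - x + x^2) = 1 + x^3]. *)
Lemma expR_le_1D (R : realType) (x : R) : 0 <= x -> expR (x - x ^+ 2) <= 1 + x.
Proof.
move=> x0; have x1 : 0 <= 1 + x by rewrite addr_ge0.
rewrite -[x - _]opprB expRN -div1r ler_pdivrMr ?expR_gt0 //.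
apply: le_trans (ler_wpM2l x1 (expR_ge1Dx _)).
have -> : (1 + x) * (1 + (x ^+ 2 - x)) = 1 + x ^+ 3 by ring.
by rewrite lerDl exprn_ge0.
Qed.

Lemma expR_le_pow1D (R : realType) (y : R) (K : nat) : (0 < K)%N -> 0 <= y ->
  expR (y - y ^+ 2 / K%:R) <= (1 + y / K%:R) ^+ K.
Proof.
move=> K0 y0; have Kr : 0 < K%:R :> R by rewrite ltr0n.
have -> : y - y ^+ 2 / K%:R = K%:R * (y / K%:R - (y / K%:R) ^+ 2).
  by field; rewrite lt0r_neq0.
have yK : 0 <= y / K%:R by rewrite divr_ge0 // ltW.
rewrite expRM_natl lerXn2r ?nnegrE ?expR_ge0 ?addr_ge0 //.
exact: expR_le_1D.
Qed.

(** With [a = n/d] and [l = n a^3 / 8], the hypotheses say that [K] lies between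
    [n a / 2] and [n a]. The upper bound gives [y >= l (1 - 4a)^4 >= l - 2 n a^4],
    the lower one gives [y^2 / K <= l^2 / K <= n a^4]. *)
Lemma twos_exponent_ge (R : realFieldType) (d n K : R) :
  0 < d -> 0 < n -> 8 * n <= d -> 0 < K -> K <= n ^+ 2 / d -> n ^+ 2 / d <= 2 * K ->
  let y := (n - 4 * K) ^+ 4 / (8 * d ^+ 3) in
  0 <= y /\
  n * (n / d) ^+ 3 / 8 - 14 * (n * (n / d) ^+ 4) <= y - y ^+ 2 / K.
Proof.
move=> d0 n0 nd K0; set a := n / d.
have -> : n ^+ 2 / d = n * a by rewrite /a; field; rewrite lt0r_neq0.
move=> Kle Kge y.
have dE : d = n / a by rewrite /a; field; rewrite !lt0r_neq0.
have a0 : 0 < a by rewrite divr_gt0.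
have a8 : a <= 1 / 8 by rewrite /a ler_pdivrMr //; lra.
have w1 : n * (1 - 4 * a) <= n - 4 * K by lra.
have w0 : 0 <= n * (1 - 4 * a) by rewrite mulr_ge0 //; lra.
have w2 : n - 4 * K <= n by lra.
set l := n * a ^+ 3 / 8.
have na3 : 0 < n * a ^+ 3 by rewrite mulr_gt0 ?exprn_gt0.
have na4 : 0 < n * a ^+ 4 by rewrite mulr_gt0 ?exprn_gt0.
have yE : y = (n - 4 * K) ^+ 4 * (a ^+ 3 / (8 * n ^+ 3)).
  by rewrite /y dE; field; rewrite !lt0r_neq0.
have f0 : 0 <= a ^+ 3 / (8 * n ^+ 3).
  apply: divr_ge0; first exact/exprn_ge0/ltW.
  by apply: mulr_ge0 => //; apply/exprn_ge0/ltW.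
have y0 : 0 <= y by rewrite yE mulr_ge0 // exprn_ge0; lra.
have yl : y <= l.
  have -> : l = n ^+ 4 * (a ^+ 3 / (8 * n ^+ 3)).
    by rewrite /l; field; rewrite lt0r_neq0.
  rewrite yE ler_wpM2r // lerXn2r ?nnegrE //; lra.
have ly : l * (1 - 16 * a) <= y.
  apply: le_trans (_ : l * (1 - 4 * a) ^+ 4 <= _).
    rewrite ler_pM2l ?divr_gt0 //.
    have -> : (1 - 4 * a) ^+ 4 =
      1 - 16 * a + (4 * a) ^+ 2 * ((1 - 4 * a) ^+ 2 + 2 * (1 - 4 * a) + 3) by ring.
    rewrite lerDl mulr_ge0 ?sqr_ge0 //.
    have := sqr_ge0 (1 - 4 * a); lra.
  have -> : l * (1 - 4 * a) ^+ 4 = (n * (1 - 4 * a)) ^+ 4 * (a ^+ 3 / (8 * n ^+ 3)).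
    by rewrite /l; field; rewrite lt0r_neq0.
  rewrite yE ler_wpM2r // lerXn2r ?nnegrE //; lra.
split=> //.
have yK : y ^+ 2 / K <= n * a ^+ 4.
  rewrite ler_pdivrMr //.
  apply: le_trans (_ : l ^+ 2 <= _); first by rewrite lerXn2r ?nnegrE //; lra.
  apply: le_trans (_ : n * a ^+ 4 * (n * a / 2) <= _); last by rewrite ler_pM2l //; lra.
  have -> : l ^+ 2 = n * a ^+ 4 * (n * a / 2) * (a / 32) by rewrite /l; field.
  have na : 0 <= n * a by rewrite mulr_ge0 // ltW.
  apply: ler_piMr; last by lra.
  by apply: mulr_ge0; [exact: ltW | lra].
have lE : l * (1 - 16 * a) = l - 2 * (n * a ^+ 4) by rewrite /l; field.
lra.
Qed.

(** The choice [K = floor(n^2 / d)] is the one for which [twos_exponent_ge]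
    applies. If [K = 0], that is [n^2 < d], the exponent is at most
    [n a^3 / 8 - 1 <= 0]; the term [-1] in the exponent is there for this case. *)
Lemma coef_theta_lower (R : realType) (N d n : nat) : (0 < n)%N -> (8 * n <= d)%N ->
  2 ^+ n * 'C(d, n)%:R *
    expR (n%:R * (n%:R / d%:R) ^+ 3 / 8 - 14 * (n%:R * (n%:R / d%:R) ^+ 4) - 1) <=
  (theta R N.+1 ^+ d)`_n.
Proof.
move=> n0 nd.
have d0 : (0 < d)%N by lia.
have nled : (n <= d)%N by lia.
have dr : 0 < d%:R :> R by rewrite ltr0n.
have nr : 0 < n%:R :> R by rewrite ltr0n.
have ndr : 8 * n%:R <= d%:R :> R by rewrite -natrM ler_nat.
have T0 : 0 <= 2 ^+ n * 'C(d, n)%:R :> R by rewrite mulr_ge0 ?exprn_ge0.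
pose K := (n * n %/ d)%N.
have Kd : (K * d <= n * n)%N by apply: leq_trunc_div.
have Kd1 : (n * n < K.+1 * d)%N by apply: ltn_ceil.
have Kdr : K%:R * d%:R <= n%:R ^+ 2 :> R by rewrite expr2 -!natrM ler_nat.
have [K0|K0] := posnP K.
  apply: le_trans (coef_theta_ge_bin R N d n nled).
  rewrite ler_piMr // -[leRHS]expR0 ler_expR.
  have nd2 : n%:R ^+ 2 / d%:R <= 1 :> R.
    by rewrite ler_pdivrMr // mul1r expr2 -natrM ler_nat; lia.
  have nd20 : 0 <= n%:R ^+ 2 / d%:R :> R by rewrite divr_ge0.
  have a0 : 0 <= n%:R / d%:R :> R by rewrite divr_ge0.
  have a1 : n%:R / d%:R <= 1 :> R by rewrite ler_pdivrMr // mul1r ler_nat.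
  (* The main term is [(n^2 / d) * a^2], and both factors are at most 1. *)
  have -> : n%:R * (n%:R / d%:R) ^+ 3 = n%:R ^+ 2 / d%:R * (n%:R / d%:R) ^+ 2 :> R.
    by field; rewrite lt0r_neq0.
  have h1 : n%:R ^+ 2 / d%:R * (n%:R / d%:R) ^+ 2 <= 1 :> R.
    by rewrite mulr_ile1 ?exprn_ge0 ?exprn_ile1.
  have h2 : 0 <= n%:R * (n%:R / d%:R) ^+ 4 :> R by rewrite mulr_ge0 ?exprn_ge0.
  lra.
have Kn : (4 * K <= n)%N.
  rewrite -(leq_pmul2r d0) -mulnA; apply: leq_trans (leq_mul (leqnn 4) Kd) _.
  by rewrite mulnCA leq_mul2l; apply/orP; right; lia.
apply: le_trans (coef_theta_ge_exp R N d n K K0 Kn nled).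
have Kr : 0 < K%:R :> R by rewrite ltr0n.
have [||y0 ye] := twos_exponent_ge R d%:R n%:R K%:R dr nr ndr Kr.
- by rewrite ler_pdivlMr.
- rewrite ler_pdivrMr // expr2 -!natrM ler_nat (leq_trans (ltnW Kd1)) //.
  by rewrite leq_mul2r; apply/orP; right; lia.
rewrite ler_wpM2l //; apply: le_trans (expR_le_pow1D R _ K K0 y0).
by rewrite ler_expR; lra.
Qed.

(** * The counts of the sphere and of the ball *)

Lemma card_sphere_double (d m : nat) : (0 < d)%N -> (2 * m.+1 <= d.+1)%N ->
  (2 * card_pts (lattice_sphere m d) <= card_pts (lattice_sphere m.+1 d))%N.
Proof.
move=> d0 md; rewrite -(ler_nat rat) natrM.
rewrite (card_lattice_sphere rat m d m) // (card_lattice_sphere rat m.+1 d m) //.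
exact: coef_theta_growth.
Qed.

(** The ball is the union of the spheres of squared radius [0, ..., n], whose sizes at least
    double from each one to the next. *)
Lemma card_ball_le_sphere (d n : nat) : (0 < d)%N -> (2 * n <= d.+1)%N ->
  (card_pts (lattice_ball n d) <= 2 * card_pts (lattice_sphere n d))%N.
Proof.
move=> d0; elim: n => [|n IHn] nd.
  suff -> : lattice_ball 0 d = lattice_sphere 0 d by rewrite mul2n -addnn leq_addr.
  apply/seteqP; split; last exact: lattice_sphere_ball.
  move=> x; rewrite /lattice_ball /lattice_sphere /= => x0.
  by apply/eqP; rewrite eq_le x0 sumr_ge0 // => i _; exact: sqr_ge0.
have -> : lattice_ball n.+1 d = lattice_ball n d `|` lattice_sphere n.+1 d.
  apply/seteqP; split=> x; rewrite /lattice_ball /lattice_sphere /=; last first.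
    by case=> [h|->] //; apply: le_trans h _; rewrite lez_nat.
  rewrite sumr_sqr_absz !lez_nat leq_eqVlt ltnS => /orP[/eqP ->|]; first by right.
  by left.
rewrite /card_pts fset_setU; [|exact: finite_lattice_ball|exact: finite_lattice_sphere].
apply: leq_trans (_ : card_pts (lattice_ball n d) + card_pts (lattice_sphere n.+1 d) <= _)%N.
  by rewrite cardfsU leq_subr.
rewrite mul2n -addnn leq_add2r.
by apply: leq_trans (card_sphere_double d n d0 nd); apply: IHn; lia.
Qed.

Lemma card_ternary_sphereE (R : realFieldType) (n d : nat) :
  (card_pts (lattice_sphere n d `&` ternary_cube d))%:R =
  2 ^+ n * 'C(d, n)%:R :> R.
Proof.
rewrite card_ternary_sphere -coef_ternary /theta /theta_tail big_geq //.
by rewrite mul0rn addr0.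
Qed.

Lemma card_pts_sub (d : nat) (A B : set 'rV[int]_d) :
  finite_set B -> A `<=` B -> (card_pts A <= card_pts B)%N.
Proof.
move=> fB AB; have fA := sub_finite_set AB fB.
by apply: fsubset_leq_card; rewrite -fset_set_sub.
Qed.

Lemma card_sphere_bounds (R : realType) (d n : nat) : (0 < n)%N -> (8 * n <= d)%N ->
  let T : R := 2 ^+ n * 'C(d, n)%:R in
  let l : R := n%:R * (n%:R / d%:R) ^+ 3 / 8 in
  let e : R := 14 * (n%:R * (n%:R / d%:R) ^+ 4) in
  T * expR (l - e - 1) <= (card_pts (lattice_sphere n d))%:R /\
  (card_pts (lattice_sphere n d))%:R <= T * expR (l + e).
Proof.
move=> n0 nd T l e; rewrite (card_lattice_sphere _ n d n.+1) ?leqW //.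
by split; [apply: coef_theta_lower | apply: coef_theta_upper; lia].
Qed.

(** [E] is [ln x] truncated from below at [- e]: an excess of at most 1 in the
    lower bound on [ln x] is moved from the exponent to a constant factor. *)
Lemma clipped_log (R : realType) (x e : R) : 0 < x -> 0 <= e ->
  expR (- e - 1) <= x -> x <= expR e ->
  exists2 E, `|E| <= e & x <= expR E <= expR 1 * x.
Proof.
move=> x0 e0; rewrite -[x]lnK //; move: (ln x) => y.
rewrite !ler_expR => lo up.
have [h|h] := leP (- e) y.
  by exists y; rewrite ?ler_norml ?h // -expRD !ler_expR lexx; lra.
exists (- e); first by rewrite normrN ger0_norm.
by rewrite -expRD !ler_expR (ltW h); lra.
Qed.

Lemma powR34_pow4 (R : realType) (x : R) : 0 <= x -> (x `^ (3 / 4)) ^+ 4 = x ^+ 3.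
Proof.
move=> x0; rewrite -powR_mulrn ?powR_ge0 // -powRrM.
have -> : 3 / 4 * 4%:R = 3%:R :> R by field.
by rewrite powR_mulrn.
Qed.

Theorem corollary1p4 (R : realType) :
  exists c C3 C4 : R, [/\ 0 < c < 1, 0 < C3, 0 < C4 &
    (exists (C : R) (E : nat -> nat -> R), 0 < C /\
      forall n d : nat, (1 <= n)%N -> (1 <= d)%N -> n%:R <= c * d%:R ->
        let alpha : R := n%:R / d%:R in
        let M : R := C3 * (2 ^+ n * 'C(d, n)%:R
                     * expR (n%:R * alpha ^+ 3 / 8 + E n d)) in
        [/\ `|E n d| <= C * (n%:R * alpha ^+ 4),
            (card_pts (lattice_sphere n d) <= card_pts (lattice_ball n d))%N,
            (card_pts (lattice_ball n d))%:R <= M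
          & M <= C4 * (card_pts (lattice_sphere n d))%:R])
    /\
    (forall A : R, 0 < A -> exists C5 : R, 0 < C5 /\
      forall n d : nat, (1 <= n)%N -> (1 <= d)%N -> n%:R <= c * d%:R ->
        n%:R <= A * d%:R `^ (3 / 4) ->
        [/\ (card_pts (lattice_sphere n d `&` ternary_cube d)
               <= card_pts (lattice_sphere n d))%N,
            (card_pts (lattice_sphere n d) <= card_pts (lattice_ball n d))%N,
            (card_pts (lattice_ball n d))%:R <= C5 * (2 ^+ n * 'C(d, n)%:R)
          & C5 * (2 ^+ n * 'C(d, n)%:R)
              = C5 * (card_pts (lattice_sphere n d `&` ternary_cube d))%:R])].
Proof.
have small (n d : nat) : n%:R <= 1 / 8 * d%:R :> R -> (8 * n <= d)%N.
  by move=> h; rewrite -(ler_nat R) natrM; lra.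
have sub (n d : nat) : (card_pts (lattice_sphere n d) <= card_pts (lattice_ball n d))%N.
  by apply: card_pts_sub (lattice_sphere_ball n d); apply: finite_lattice_ball.
have ball (n d : nat) : (1 <= d)%N -> (8 * n <= d)%N ->
    (card_pts (lattice_ball n d))%:R <= 2 * (card_pts (lattice_sphere n d))%:R :> R.
  by move=> d0 nd; rewrite -natrM ler_nat card_ball_le_sphere //; lia.
exists (1 / 8), 2, (2 * expR 1); split=> //; first lra.
split.
  (* The error term has to be a total function of [n] and [d]; outside the
     range of the theorem its value is 0. *)
  pose P (n d : nat) (E : R) :=
     let T : R := 2 ^+ n * 'C(d, n)%:R in
     let S : R := (card_pts (lattice_sphere n d))%:R in
     let l : R := n%:R * (n%:R / d%:R) ^+ 3 / 8 in
     `|E| <= 14 * (n%:R * (n%:R / d%:R) ^+ 4) /\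
     S <= T * expR (l + E) <= expR 1 * S.
  have exE (n d : nat) : exists E, (0 < n)%N -> (8 * n <= d)%N -> P n d E.
    have [/andP[n0 nd]|h] := boolP ((0 < n) && (8 * n <= d))%N; last first.
      by exists 0 => n0 nd; rewrite n0 nd in h.
    have := card_sphere_bounds R d n n0 nd; rewrite /P.
    set T := 2 ^+ n * _; set l := _ / 8; set e := 14 * _; set S := (card_pts _)%:R.
    move=> /= [lo up].
    have T0 : 0 < T by rewrite mulr_gt0 ?exprn_gt0 // ltr0n bin_gt0; lia.
    have Tl0 : 0 < T * expR l by rewrite mulr_gt0 ?expR_gt0.
    have e0 : 0 <= e by rewrite mulr_ge0 // mulr_ge0 ?exprn_ge0 ?divr_ge0.
    have S0 : 0 < S by apply: lt_le_trans lo; apply: mulr_gt0 T0 (expR_gt0 _).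
    have [|||E Ee /andP[h1 h2]] := clipped_log R (S / (T * expR l)) e _ e0.
    - by rewrite divr_gt0.
    - by rewrite ler_pdivlMr // mulrC -mulrA -expRD addrA.
    - by rewrite ler_pdivrMr // mulrC -mulrA -expRD.
    exists E => _ _; split=> //; rewrite expRD mulrA mulrC.
    move: h1; rewrite ler_pdivrMr // => ->.
    by move: h2; rewrite [expR 1 * _]mulrA ler_pdivlMr.
  have {exE} /choice[E EP] := fun nd : nat * nat => exE nd.1 nd.2.
  exists 14, (fun n d => E (n, d)); split=> // n d n0 d0 /small nd alpha M.
  have [Ee /andP[h1 h2]] := EP (n, d) n0 nd.
  split=> //.
    by apply: le_trans (ball n d d0 nd) _; rewrite ler_pM2l.
  by rewrite /M -[leRHS]mulrA ler_pM2l.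
move=> A A0; exists (2 * expR (A ^+ 4 / 8 + 14 * A ^+ 4)).
split; first by rewrite mulr_gt0 ?expR_gt0.
move=> n d n0 d0 /small nd nA; split=> //.
- by apply: card_pts_sub; [exact: finite_lattice_sphere | exact: subIsetl].
- apply: le_trans (ball n d d0 nd) _; rewrite -mulrA ler_pM2l // mulrC.
  have [_ up] := card_sphere_bounds R d n n0 nd.
  apply: le_trans up _; rewrite ler_wpM2l ?mulr_ge0 ?exprn_ge0 // ler_expR.
  have dr : 0 < d%:R :> R by rewrite ltr0n.
  have a0 : 0 <= n%:R / d%:R :> R by rewrite divr_ge0.
  have a1 : n%:R / d%:R <= 1 :> R by rewrite ler_pdivrMr // mul1r ler_nat; lia.
  have n3 : n%:R * (n%:R / d%:R) ^+ 3 <= A ^+ 4.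
    have -> : n%:R * (n%:R / d%:R) ^+ 3 = n%:R ^+ 4 / d%:R ^+ 3 :> R.
      by field; rewrite lt0r_neq0.
    rewrite ler_pdivrMr ?exprn_gt0 // -(powR34_pow4 R d%:R) // -exprMn.
    by rewrite lerXn2r ?nnegrE // mulr_ge0 ?powR_ge0 // ltW.
  have n4 : n%:R * (n%:R / d%:R) ^+ 4 <= n%:R * (n%:R / d%:R) ^+ 3 :> R.
    by rewrite ler_wpM2l // exprS ler_piMl ?exprn_ge0.
  lra.
- by rewrite card_ternary_sphereE.
Qed.
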